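(* Let $d, D_\Phi, M \ge 1$ be integers with $D_\Phi\ge d$, let $\beta>0$ and $\alpha\in[1,2]$, let $\Xi=[\xi_1,\dots,\xi_M]\in\mathbb{R}^{d\times M}$, and let $W\in\mathbb{R}^{D_\Phi\times d}$. Put $\Phi(u)=Wu$ and $\mathcal{K}(u,v)=\langle \Phi(u),\Phi(v)\rangle=u^{\mathsf T}W^{\mathsf T}Wv$ for $u,v\in\mathbb{R}^d$, and $\mathcal{K}(\Xi,x)=(\mathcal{K}(\xi_1,x),\dots,\mathcal{K}(\xi_M,x))\in\mathbb{R}^M$. Define the energy and retrieval dynamics $$E_{\mathcal K}(x)=\tfrac12\,\mathcal{K}(x,x)-\Psi^\star_\alpha\big(\beta,\mathcal{K}(\Xi,x)\big),\qquad \mathcal{T}_{\mathcal K}(x)=\Xi\cdot \mathrm{Sep}_\alpha\big(\beta,\mathcal{K}(\Xi,x)\big),\qquad x\in\mathbb{R}^d .$$ Then for any sequence $\{x_t\}_{t=0}^\infty$ in $\mathbb{R}^d$ generated by the iteration $x_{t+1}=\mathcal{T}_{\mathcal K}(x_t)$, all limit points of this sequence are stationary points of $E_{\mathcal K}$.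
   Context: Let $\Delta^M=\{p\in\mathbb{R}^M: p_\mu\ge 0,\ \sum_{\mu=1}^M p_\mu=1\}$. The Tsallis entropy is $\Psi_\alpha(p)=\frac{1}{\alpha(\alpha-1)}\sum_{\mu=1}^M(p_\mu-p_\mu^\alpha)$ for $\alpha\neq1$ and $\Psi_1(p)=-\sum_{\mu=1}^M p_\mu\ln p_\mu$ (with $0\ln 0=0$). For $z\in\mathbb{R}^M$, $\alpha\text{-EntMax}(z)=\operatorname{argmax}_{p\in\Delta^M}[\langle p,z\rangle+\Psi_\alpha(p)]$. For $\alpha=1$ this is $\mathrm{Softmax}(z)$, and for $\alpha=2$ it is $\mathrm{Sparsemax}(z)$, the Euclidean projection of $z$ onto $\Delta^M$. The separation function is $\mathrm{Sep}_\alpha(\beta,z)=\alpha\text{-EntMax}(\beta z)$; thus $\mathrm{Sep}_1(\beta,z)=\mathrm{Softmax}(\beta z)$ and $\mathrm{Sep}_2(\beta,z)=\mathrm{Sparsemax}(\beta z)$. The function $\Psi^\star_\alpha(\beta,\cdot):\mathbb{R}^M\to\mathbb{R}$ is: for $\alpha=1$, $\Psi^\star_1(\beta,z)=\frac1\beta\log\sum_{\mu=1}^M e^{\beta z_\mu}$; for $\alpha=2$, $\Psi^\star_2(\beta,z)=\frac1\beta\big(\frac12\|\beta z\|^2-\frac12\|z^\star-\beta z\|^2+\frac12\big)$ with $z^\star=\mathrm{Sparsemax}(\beta z)$; for general $\alpha\in[1,2]$, $\Psi^\star_\alpha(\beta,\cdot)=\int \alpha\text{-EntMax}(\beta z)\,dz$,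 i.e. a function whose gradient in $z$ is $\alpha\text{-EntMax}(\beta z)$ (the formulas for $\alpha=1,2$ are instances; the additive constant is immaterial). A limit point of a sequence is a limit of some subsequence. A stationary point of $E_{\mathcal K}$ is a point where its gradient vanishes. *)

(* Defs.v *)
From HB Require Import structures.
From mathcomp Require Import all_boot all_order all_algebra.
From mathcomp Require Import all_classical all_reals all_analysis.

Set Implicit Arguments.
Unset Strict Implicit.
Unset Printing Implicit Defensive.

Import Order.TTheory GRing.Theory Num.Theory.
Import numFieldNormedType.Exports.

Local Open Scope classical_set_scope.
Local Open Scope ring_scope.

(* The library norm on matrices is the sup norm, so the Euclidean structure of
   R^n is given through [dotp]; the two norms induce the same topology and the
   same differentials. *)
Definition dotp (R : realType) (n : nat) (u v : 'cV[R]_n) : R :=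
  \sum_(i < n) u i 0 * v i 0.

Definition sqnorm (R : realType) (n : nat) (u : 'cV[R]_n) : R := dotp u u.

(* F is (Frechet) differentiable at x with gradient g. *)
Definition has_gradient (R : realType) (n : nat)
    (F : 'cV[R]_n -> R) (x g : 'cV[R]_n) : Prop :=
  is_diff x F (dotp g).

Definition stationary_point (R : realType) (n : nat)
    (F : 'cV[R]_n -> R) (x : 'cV[R]_n) : Prop :=
  has_gradient F x 0.

Definition subseq_limit_point (T : topologicalType) (u : nat -> T) (l : T) : Prop :=
  exists2 f : nat -> nat,
    {homo f : m n / (m < n)%N} & (fun k => u (f k)) @ \oo --> l.

Definition simplex (R : realType) (M : nat) : set 'cV[R]_M :=
  [set p | (forall mu, 0 <= p mu 0) /\ \sum_(mu < M) p mu 0 = 1].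
Arguments simplex : clear implicits.

(* [ln 0 = 0] in the library, so the term of index mu vanishes if p_mu = 0. *)
Definition tsallis (R : realType) (M : nat) (alpha : R) (p : 'cV[R]_M) : R :=
  if alpha == 1 then - \sum_(mu < M) p mu 0 * ln (p mu 0)
  else (alpha * (alpha - 1))^-1 * \sum_(mu < M) (p mu 0 - p mu 0 `^ alpha).

(* [get P] is an element of P, if there is one. For 1 <= alpha <= 2 and 0 < M
   the maximizer exists and is unique. *)
Definition entmax (R : realType) (M : nat) (alpha : R) (z : 'cV[R]_M) :
    'cV[R]_M :=
  get [set p | simplex R M p /\ forall q, simplex R M q ->
                 dotp q z + tsallis alpha q <= dotp p z + tsallis alpha p].

Definition sparsemax (R : realType) (M : nat) (z : 'cV[R]_M) : 'cV[R]_M :=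
  get [set p | simplex R M p /\ forall q, simplex R M q ->
                 sqnorm (p - z) <= sqnorm (q - z)].

Definition Sep (R : realType) (M : nat) (alpha beta : R) (z : 'cV[R]_M) :
    'cV[R]_M :=
  entmax alpha (beta *: z).

Definition Psi_star1 (R : realType) (M : nat) (beta : R) (z : 'cV[R]_M) : R :=
  beta^-1 * ln (\sum_(mu < M) expR (beta * z mu 0)).

Definition Psi_star2 (R : realType) (M : nat) (beta : R) (z : 'cV[R]_M) : R :=
  beta^-1 * (2^-1 * sqnorm (beta *: z)
             - 2^-1 * sqnorm (sparsemax (beta *: z) - beta *: z) + 2^-1).

(* F is an admissible choice of Psi^*_alpha(beta, _): one of the closed formulas
   for alpha = 1 and alpha = 2, or, for any alpha, an arbitrary antiderivative
   of Sep_alpha(beta, _), the additive constant being left free. *)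
Definition is_Psi_star (R : realType) (M : nat) (alpha beta : R)
    (F : 'cV[R]_M -> R) : Prop :=
  [\/ alpha = 1 /\ (forall z, F z = Psi_star1 beta z),
      alpha = 2 /\ (forall z, F z = Psi_star2 beta z)
    | forall z, has_gradient F z (Sep alpha beta z)].

Definition Phi (R : realType) (d D : nat) (W : 'M[R]_(D, d)) (u : 'cV[R]_d) :
    'cV[R]_D :=
  W *m u.

Definition kernelK (R : realType) (d D : nat) (W : 'M[R]_(D, d))
    (u v : 'cV[R]_d) : R :=
  dotp (Phi W u) (Phi W v).

(* The patterns xi_mu are the columns of Xi. *)
Definition kernelXi (R : realType) (d D M : nat) (W : 'M[R]_(D, d))
    (Xi : 'M[R]_(d, M)) (x : 'cV[R]_d) : 'cV[R]_M :=
  \col_(mu < M) kernelK W (col mu Xi) x.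

Definition energy (R : realType) (d D M : nat) (W : 'M[R]_(D, d))
    (Xi : 'M[R]_(d, M)) (Psi : 'cV[R]_M -> R) (x : 'cV[R]_d) : R :=
  2^-1 * kernelK W x x - Psi (kernelXi W Xi x).

Definition retrieval (R : realType) (d D M : nat) (W : 'M[R]_(D, d))
    (Xi : 'M[R]_(d, M)) (alpha beta : R) (x : 'cV[R]_d) : 'cV[R]_d :=
  Xi *m Sep alpha beta (kernelXi W Xi x).

(* Main.v *)
(* Let L be the energy built from V(z) / beta, where V is the convex conjugate of
   the negative Tsallis entropy.  For alpha in [1, 2] the entropy terms have
   second derivative - p^(alpha - 2) <= -1 on ]0, 1], so the entropy is strongly
   concave on the simplex.  Hence alpha-EntMax is single valued and Lipschitz,
   and V is differentiable with gradient alpha-EntMax.  Convexity of V turns one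
   retrieval step into the descent
     |W x_t - W x_(t+1)|^2 / 2 <= L(x_t) - L(x_(t+1)).
   L is continuous and decreases along the orbit, so along a subsequence
   converging to y the right-hand side tends to 0; by continuity
   W y = W T(y), which is the vanishing of the gradient
   W^T (W y - W T(y)) of the energy at y. *)

Require Import Defs.
From HB Require Import structures.
From mathcomp Require Import all_boot all_order all_algebra.
From mathcomp Require Import all_classical all_reals all_analysis.
From mathcomp Require Import ring lra.
Set Implicit Arguments.
Unset Strict Implicit.
Unset Printing Implicit Defensive.
Import Order.TTheory GRing.Theory Num.Theory.
Import numFieldNormedType.Exports.
Local Open Scope classical_set_scope.
Local Open Scope ring_scope.

(** * Euclidean inner product and comparison with the sup norm *)

Lemma dotpE (R : realType) n (u v : 'cV[R]_n) : dotp u v = (u^T *m v) 0 0.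
Proof. by rewrite mxE; apply: eq_bigr => i _; rewrite mxE. Qed.

Lemma dotpC (R : realType) n (u v : 'cV[R]_n) : dotp u v = dotp v u.
Proof. by apply: eq_bigr => i _; rewrite mulrC. Qed.

Lemma dotp_is_linear (R : realType) n (u : 'cV[R]_n) : linear (dotp u).
Proof. by move=> a v w; rewrite !dotpE linearP/= !mxE. Qed.

HB.instance Definition _ (R : realType) n (u : 'cV[R]_n) :=
  GRing.isLinear.Build R 'cV[R]_n R _ (dotp u) (dotp_is_linear u).

Lemma dotpDl (R : realType) n (u v w : 'cV[R]_n) :
  dotp (u + v) w = dotp u w + dotp v w.
Proof. by rewrite dotpC linearD/= !(dotpC w). Qed.

Lemma dotpBl (R : realType) n (u v w : 'cV[R]_n) :
  dotp (u - v) w = dotp u w - dotp v w.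
Proof. by rewrite dotpC linearB/= !(dotpC w). Qed.

Lemma dotpZl (R : realType) n a (u v : 'cV[R]_n) :
  dotp (a *: u) v = a * dotp u v.
Proof. by rewrite dotpC linearZ/= (dotpC v). Qed.

Lemma dotpZr (R : realType) n a (u v : 'cV[R]_n) :
  dotp u (a *: v) = a * dotp u v.
Proof. exact: linearZ. Qed.

Lemma dotpBr (R : realType) n (u v w : 'cV[R]_n) :
  dotp w (u - v) = dotp w u - dotp w v.
Proof. exact: linearB. Qed.

Lemma dotp_mulmxr (R : realType) m n (A : 'M[R]_(m, n)) u v :
  dotp u (A *m v) = dotp (A^T *m u) v.
Proof. by rewrite !dotpE trmx_mul trmxK mulmxA. Qed.

Lemma sqnorm_ge0 (R : realType) n (u : 'cV[R]_n) : 0 <= sqnorm u.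
Proof. by apply: sumr_ge0 => i _; rewrite -expr2 sqr_ge0. Qed.

Lemma sqnorm_eq0 (R : realType) n (u : 'cV[R]_n) : sqnorm u <= 0 -> u = 0.
Proof.
move=> u0; have /eqP : sqnorm u = 0 by apply/eqP; rewrite eq_le u0 sqnorm_ge0.
rewrite psumr_eq0 => [/allP u_eq0|i _]; last by rewrite -expr2 sqr_ge0.
apply/colP => i; rewrite mxE; apply/eqP.
by have := u_eq0 i; rewrite mem_index_enum -expr2 sqrf_eq0 => /(_ isT).
Qed.

Lemma sqnormD (R : realType) n (u v : 'cV[R]_n) :
  sqnorm (u + v) = sqnorm u + 2 * dotp u v + sqnorm v.
Proof. rewrite /sqnorm linearD/= !dotpDl (dotpC v u); ring. Qed.

Lemma sqnormZ (R : realType) n a (u : 'cV[R]_n) :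
  sqnorm (a *: u) = a ^+ 2 * sqnorm u.
Proof. by rewrite /sqnorm dotpZr dotpZl mulrA expr2. Qed.

Lemma sqnormB (R : realType) n (u v : 'cV[R]_n) :
  sqnorm (u - v) = sqnorm u - 2 * dotp u v + sqnorm v.
Proof. by rewrite sqnormD -scaleN1r sqnormZ dotpZr; ring. Qed.

(** Young's inequality, from |u/2 - v|^2 >= 0. The weight 1/4 is small enough to be absorbed by the
    gap |p - q|^2/2 in [entmax_lipschitz]. *)
Lemma dotp_le_sqnorm (R : realType) n (u v : 'cV[R]_n) :
  dotp u v <= 4^-1 * sqnorm u + sqnorm v.
Proof.
have := sqnorm_ge0 (2^-1 *: u - v); rewrite sqnormB sqnormZ dotpZl; lra.
Qed.

Lemma coord_le_norm (R : realType) n (u : 'cV[R]_n) i : `|u i 0| <= `|u|.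
Proof.
rewrite [leRHS]/Num.norm/= mx_normrE.
by apply/bigmax_geP; right => /=; exists (i, 0).
Qed.

Lemma norm_le_coord (R : realType) n (u : 'cV[R]_n) e :
  0 <= e -> (forall i, `|u i 0| <= e) -> `|u| <= e.
Proof.
move=> e0 ue; rewrite [leLHS]/Num.norm/= mx_normrE.
by apply/bigmax_leP; split=> // -[i j] _ /=; rewrite ord1.
Qed.

Lemma sqr_coord_le_sqnorm (R : realType) n (u : 'cV[R]_n) i :
  u i 0 ^+ 2 <= sqnorm u.
Proof.
rewrite /sqnorm /dotp (bigD1 i)//= -expr2 lerDl.
by apply: sumr_ge0 => j _; rewrite -expr2 sqr_ge0.
Qed.

Lemma sqnorm_le_norm (R : realType) n (u : 'cV[R]_n) :
  sqnorm u <= n%:R * `|u| ^+ 2.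
Proof.
rewrite mulr_natl -[X in _ *+ X]card_ord -sumr_const.
apply: ler_sum => i _; rewrite -expr2 -real_normK ?num_real//.
by rewrite lerXn2r ?nnegrE// coord_le_norm.
Qed.

(** * Gradients and differentials on column vectors *)

Lemma linear_cV_continuous (R : realType) n (V : normedModType R)
  (f : {linear 'cV[R]_n -> V}) : continuous f.
Proof.
(* Expansion in the standard basis reduces the claim to the coordinate functions. *)
have -> : (f : 'cV[R]_n -> V) =
    \sum_(i < n) (fun u : 'cV[R]_n => u i 0 *: f (delta_mx i 0)).
  apply/funext => u; rewrite fct_sumE [in LHS](matrix_sum_delta u) linear_sum.
  by apply: eq_bigr => i _; rewrite big_ord1 linearZ.
move=> u; apply: differentiable_continuous; apply: differentiable_sum => i.
exact/differentiableZl/differentiable_coord.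
Qed.

Lemma linear_cV_is_diff (R : realType) n (V : normedModType R)
  (f : {linear 'cV[R]_n -> V}) (x : 'cV[R]_n) : is_diff x f f.
Proof.
have fc := @linear_cV_continuous _ _ _ f.
by apply: DiffDef; [exact: linear_differentiable|exact: diff_lin].
Qed.

Lemma has_gradient_mulmx (R : realType) m n (A : 'M[R]_(m, n))
    (F : 'cV[R]_m -> R) x g :
  has_gradient F (A *m x) g ->
  has_gradient (fun u => F (A *m u)) x (A^T *m g).
Proof.
move=> Fg; rewrite /has_gradient.
have -> : dotp (A^T *m g) = dotp g \o mulmx A.
  by apply/funext => h /=; rewrite dotp_mulmxr.
exact/(is_diff_comp (linear_cV_is_diff (mulmx A) x)).
Qed.

Lemma has_gradientB (R : realType) n (F G : 'cV[R]_n -> R) x f g :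
  has_gradient F x f -> has_gradient G x g ->
  has_gradient (fun u => F u - G u) x (f - g).
Proof.
move=> Ff Gg; rewrite /has_gradient.
have -> : dotp (f - g) = dotp f - dotp g :> ('cV[R]_n -> R).
  by apply/funext => h; rewrite dotpBl.
exact: is_diffB.
Qed.

(** [sqnorm h] is at most n times the squared library norm, so a quadratic remainder is o(h) and the
    linear part of the expansion is the differential. *)
Lemma has_gradient_quadratic (R : realType) n (F : 'cV[R]_n -> R)
    (x g : 'cV[R]_n) C :
  (forall h, `|F (x + h) - F x - dotp g h| <= C * sqnorm h) ->
  has_gradient F x g.
Proof.
move=> Fq; have gc := @linear_cV_continuous _ _ _ (dotp g).
have Fo e : 0 < e -> \forall h \near (0 : 'cV[R]_n),
    `|F (x + h) - F x - dotp g h| <= e * `|h|.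
  (* The summand 1 keeps [D] positive; where |h| <= e/D, the bound D |h|^2 is at most e |h|. *)
  move=> e0; pose D := `|C| * n%:R + 1.
  have D0 : 0 < D by rewrite ltr_wpDl// mulr_ge0.
  have De0 : 0 < D^-1 * e by rewrite mulr_gt0 ?invr_gt0.
  apply: filterS (@nbhs0_le R 'cV[R]_n _ De0) => h hD.
  rewrite (le_trans (Fq h))//.
  apply: (@le_trans _ _ (D * `|h| * `|h|)).
    apply: (@le_trans _ _ (`|C| * (n%:R * `|h| ^+ 2))).
      apply: (@le_trans _ _ (`|C| * sqnorm h)).
        by rewrite ler_wpM2r ?sqnorm_ge0// ler_norm.
      by rewrite ler_wpM2l// sqnorm_le_norm.
    rewrite -[leRHS]mulrA -expr2 mulrA ler_wpM2r ?sqr_ge0// /D lerDl//.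
  rewrite ler_wpM2r// -ler_pdivlMl//.
have Fo' : F \o shift x =
    cst (F x) + (dotp g : 'cV[R]_n -> R) +o_ (0 : 'cV[R]_n) id.
  apply/eqaddoP => e e0.
  apply: filterS (Fo e e0) => h; rewrite !fctE/= (addrC h) opprD addrA; exact.
have dE := diff_unique gc Fo'.
by apply: DiffDef => //; apply/diff_locallyP; rewrite dE.
Qed.

Lemma has_gradient_continuous (R : realType) n (F : 'cV[R]_n -> R) x g :
  has_gradient F x g -> {for x, continuous F}.
Proof. by case=> dF _; exact: differentiable_continuous. Qed.

Lemma half_sqnorm_gradient (R : realType) n (x : 'cV[R]_n) :
  has_gradient (fun u => 2^-1 * sqnorm u) x x.
Proof.
apply: (@has_gradient_quadratic _ _ _ _ _ 2^-1) => h; rewrite sqnormD.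
rewrite [X in `|X|](_ : _ = 2^-1 * sqnorm h); last by lra.
by rewrite ger0_norm// mulr_ge0 ?invr_ge0// sqnorm_ge0.
Qed.

(** * Strong concavity of the entropy terms on [0, 1] *)

Lemma midpoint_strong_concavity (R : realType) (f df : R -> R) :
  continuous f ->
  (forall x : R, 0 < x < 1 -> is_derive x 1 f (df x)) ->
  (forall x y : R, 0 < x -> x <= y -> y < 1 -> y - x <= df x - df y) ->
  forall a b, 0 <= a <= 1 -> 0 <= b <= 1 ->
  2^-1 * (f a + f b) + 8^-1 * (a - b) ^+ 2 <= f (2^-1 * (a + b)).
Proof.
move=> fc fd df_decr a b; wlog ab : a b / a <= b => [wlg|] a01 b01.
  have [ab|ba] := leP a b; first exact: wlg.
  rewrite (addrC (f a)) (addrC a b) -sqrrN opprB.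
  by apply: wlg => //; apply: ltW.
have [<-|a_neq_b] := eqVneq a b.
  rewrite subrr expr0n/= mulr0 addr0 (_ : 2^-1 * (a + a) = a); last by lra.
  lra.
have {a_neq_b}ab : a < b by rewrite lt_neqAle a_neq_b.
set m := 2^-1 * (a + b).
have am : a < m by rewrite /m; lra.
have mb : m < b by rewrite /m; lra.
(* The derivative of [g] is nonincreasing, so by the mean value theorem [g] grows no more on [m, b]
   than on [a, m]. Undoing the shift by x^2/2 leaves (a^2 + b^2)/4 - (a + b)^2/8 = (a - b)^2/8. *)
pose g x : R := f x + 2^-1 * x ^+ 2.
have gd (x : R) : 0 < x < 1 -> is_derive x 1 g (df x + x).
  move=> /fd ?; rewrite /g; apply: is_derive_eq.
  rewrite /GRing.scale/=; lra.
have gc A : {within A, continuous g}.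
  apply: continuous_subspaceT => x; apply: cvgD; first exact: fc.
  by apply: cvgM; [exact: cvg_cst|exact: exprn_continuous].
have gd_itv (u v : R) : 0 <= u -> v <= 1 ->
    forall x, x \in `]u, v[%R -> is_derive x 1 g (df x + x).
  by move=> u0 v1 x; rewrite in_itv/= => xuv; apply: gd; lra.
have a0 : 0 <= a by lra.
have b1 : b <= 1 by lra.
have m0 : 0 <= m by lra.
have m1 : m <= 1 by lra.
have [c1] := MVT am (gd_itv a m a0 m1) (gc _).
rewrite in_itv/= => c1am gam.
have [c2] := MVT mb (gd_itv m b m0 b1) (gc _).
rewrite in_itv/= => c2mb gmb.
have c12 : df c2 + c2 <= df c1 + c1.
  have : c2 - c1 <= df c1 - df c2 by apply: df_decr; lra.
  lra.
have : g b - g m <= g m - g a.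
  rewrite gam gmb (_ : b - m = m - a); last by rewrite /m; lra.
  by rewrite ler_wpM2r//; lra.
rewrite /g => gle; rewrite /m in gle *; lra.
Qed.

(* The absolute values make the summand continuous on the whole line; on the
   simplex they are void. *)
Definition tsallis_term (R : realType) (alpha p : R) : R :=
  if alpha == 1 then - (`|p| * ln `|p|)
  else (alpha * (alpha - 1))^-1 * (`|p| - `|p| `^ alpha).

Lemma tsallis_sum (R : realType) M (alpha : R) (p : 'cV[R]_M) :
  simplex R M p -> tsallis alpha p = \sum_(mu < M) tsallis_term alpha (p mu 0).
Proof.
case=> p0 _; rewrite /tsallis /tsallis_term; case: ifP => _.
  by rewrite -sumrN; apply: eq_bigr => i _; rewrite ger0_norm.
by rewrite mulr_sumr; apply: eq_bigr => i _; rewrite ger0_norm.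
Qed.

(** With s the square root of x, -ln s = ln (1/s) < 1/s, hence -x ln x = 2 x (-ln s) <= 2 s. This
    majorant gives the continuity of x ln x at 0. *)
Lemma abs_mul_ln_le (R : realType) (x : R) :
  0 < x <= 1 -> `|x * ln x| <= 2 * Num.sqrt x.
Proof.
move=> /andP[x0 x1]; rewrite ler0_norm; last first.
  by apply: mulr_ge0_le0; [exact: ltW|exact: ln_le0].
have s0 : 0 < Num.sqrt x by rewrite sqrtr_gt0.
have xE : x = Num.sqrt x ^+ 2 by rewrite sqr_sqrtr// ltW.
have := @ln_sublinear _ (Num.sqrt x)^-1; rewrite invr_gt0 => /(_ s0).
rewrite lnV// => lns.
rewrite [in X in - (_ * X)]xE lnXn// mulr2n.
have -> : - (x * (ln (Num.sqrt x) + ln (Num.sqrt x))) =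
    2 * (x * - ln (Num.sqrt x)) by ring.
rewrite ler_wpM2l// (@le_trans _ _ (x * (Num.sqrt x)^-1))//.
  by rewrite ler_wpM2l ?ltW.
by rewrite [X in X * _]xE expr2 mulfK ?gt_eqF.
Qed.

Lemma abs_mul_ln_continuous (R : realType) :
  continuous (fun p : R => `|p| * ln `|p|).
Proof.
move=> p; have [->|p0] := eqVneq p 0; last first.
  apply: cvgM; first exact: norm_continuous.
  apply: continuous_cvg; last exact: norm_continuous.
  by apply: continuous_ln; rewrite normr_gt0.
rewrite /continuous_at normr0 mul0r; apply/norm_cvg0P.
apply: (@squeeze_cvgr _ _ _ _ (fun=> 0) (fun p : R => 2 * Num.sqrt `|p|)).
- near=> x; rewrite normr_ge0/=.
  have [->|x0] := eqVneq x 0; first by rewrite normr0 mul0r normr0 mulr_ge0.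
  apply: abs_mul_ln_le; rewrite normr_gt0 x0/=.
  by near: x; exact: (@nbhs0_le R R^o 1 ltr01).
- exact: cvg_cst.
- rewrite -[X in _ --> X](mulr0 2); apply: cvgM; first exact: cvg_cst.
  have sc : {for 0, continuous (@Num.sqrt R)} by exact: sqrt_continuous.
  rewrite -[X in _ --> X](@sqrtr0 R); apply: (continuous_cvg _ sc).
  by apply/norm_cvg0P; exact: cvg_id.
Unshelve. all: by end_near. Qed.

Lemma abs_powR_continuous (R : realType) (alpha : R) :
  1 <= alpha -> continuous (fun p : R => `|p| `^ alpha).
Proof.
move=> a1 p; have [->|p0] := eqVneq p 0; last first.
  have pc : {for `|p|, continuous (fun x : R => x `^ alpha)}.
    apply/differentiable_continuous/derivable1_diffP.
    by apply: derivable_powR; rewrite in_itv/= andbT normr_gt0.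
  by apply: (continuous_cvg _ pc); exact: norm_continuous.
rewrite /continuous_at normr0 powR0 ?gt_eqF ?(lt_le_trans ltr01)//.
(* Near 0 one has |p| <= 1, where an exponent at least 1 can only decrease |p|. *)
apply: (@squeeze_cvgr _ _ _ _ (fun=> 0) (fun p : R => `|p|)).
- near=> x; rewrite powR_ge0/=.
  have [->|x0] := eqVneq x 0.
    by rewrite normr0 powR0// gt_eqF// (lt_le_trans ltr01).
  apply: ge1r_powR => //; rewrite normr_gt0 x0/=.
  by near: x; exact: (@nbhs0_le R R^o 1 ltr01).
- exact: cvg_cst.
- by apply/norm_cvg0P; exact: cvg_id.
Unshelve. all: by end_near. Qed.

Lemma tsallis_term_continuous (R : realType) (alpha : R) :
  1 <= alpha -> continuous (tsallis_term alpha).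
Proof.
move=> a1 p; rewrite /tsallis_term; case: (alpha == 1).
  by apply: cvgN; exact: abs_mul_ln_continuous.
apply: cvgM; first exact: cvg_cst.
by apply: cvgB; [exact: norm_continuous|exact: abs_powR_continuous].
Qed.

Definition tsallis_term_deriv (R : realType) (alpha p : R) : R :=
  if alpha == 1 then - (ln p + 1)
  else (alpha * (alpha - 1))^-1 * (1 - alpha * p `^ (alpha - 1)).

Lemma tsallis_term_is_derive (R : realType) (alpha x : R) :
  0 < x -> is_derive x 1 (tsallis_term alpha) (tsallis_term_deriv alpha x).
Proof.
move=> x0.
apply: (@near_eq_is_derive _ _ _ (fun p : R => if alpha == 1 then - (p * ln p)
  else (alpha * (alpha - 1))^-1 * (p - p `^ alpha))) => //.
  near=> y; have y0 : 0 < y by near: y; exact: lt_nbhsr.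
  by rewrite /tsallis_term gtr0_norm.
have dln := is_derive1_ln x0; have dpow := is_derive1_powR alpha x0.
rewrite /tsallis_term_deriv; case: (alpha == 1).
  apply: is_derive_eq; rewrite /GRing.scale/=; field; rewrite gt_eqF//.
have dB := is_deriveB (is_derive_id x 1) dpow.
have dZ := is_deriveZ (alpha * (alpha - 1))^-1 dB.
exact: dZ.
Unshelve. all: by end_near. Qed.

(** Mean value theorem: the derivative s c^(s - 1) is at least s, because c < 1 and s - 1 <= 0. *)
Lemma powR_increment (R : realType) (s x y : R) :
  0 < s <= 1 -> 0 < x -> x <= y -> y < 1 -> s * (y - x) <= y `^ s - x `^ s.
Proof.
move=> /andP[s0 s1] x0 xy y1.
have pd (z : R) : z \in `]x, y[%R ->
    is_derive z 1 (fun u : R => u `^ s) (s * z `^ (s - 1)).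
  by rewrite in_itv/= => /andP[xz zy]; apply: is_derive1_powR; lra.
have pc : {within `[x, y], continuous (fun u : R => u `^ s)}.
  apply: derivable_within_continuous => z; rewrite in_itv/= => /andP[xz zy].
  by apply: derivable_powR; rewrite in_itv/= andbT; lra.
have [c] := MVT_segment xy pd pc.
rewrite in_itv/= => /andP[xc cy] ->; rewrite -mulrA.
rewrite ler_wpM2l ?(ltW s0)// ler_peMl ?subr_ge0//.
have c0 : 0 < c by lra.
by rewrite -[leLHS](powRr0 c); apply: ger_powR; lra.
Qed.

(** Integrated form of the bound -p^(alpha - 2) <= -1 on the second derivative. For alpha = 1 it
    follows from ln u <= u - 1 at u = x/y and from y < 1; otherwise from [powR_increment] with s =
    alpha - 1, whose factor s cancels the prefactor. *)
Lemma tsallis_term_deriv_decr (R : realType) (alpha x y : R) :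
  1 <= alpha <= 2 -> 0 < x -> x <= y -> y < 1 ->
  y - x <= tsallis_term_deriv alpha x - tsallis_term_deriv alpha y.
Proof.
move=> /andP[a1 a2] x0 xy y1; rewrite /tsallis_term_deriv.
have y0 : 0 < y := lt_le_trans x0 xy.
case: ifPn => [_|an1].
  have : ln (x / y) <= x / y - 1.
    have := @le_ln1Dx _ (x / y - 1); rewrite addrCA subrr addr0; apply.
    have : 0 < x / y by rewrite divr_gt0.
    lra.
  rewrite ln_div// => lnxy.
  have : y - x <= 1 - x / y.
    have -> : 1 - x / y = (y - x) / y by rewrite mulrBl divff ?gt_eqF.
    by rewrite ler_peMr ?subr_ge0// invf_ge1 ?ltW.
  lra.
have s0 : 0 < alpha - 1 by rewrite subr_gt0 lt_neqAle eq_sym an1.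
have inc : (alpha - 1) * (y - x) <= y `^ (alpha - 1) - x `^ (alpha - 1).
  by apply: powR_increment => //; lra.
have -> : (alpha * (alpha - 1))^-1 * (1 - alpha * x `^ (alpha - 1)) -
    (alpha * (alpha - 1))^-1 * (1 - alpha * y `^ (alpha - 1)) =
    (alpha - 1)^-1 * (y `^ (alpha - 1) - x `^ (alpha - 1)).
  by field; apply/andP; split; rewrite gt_eqF//; lra.
by rewrite mulrC ler_pdivlMr// mulrC.
Qed.

Lemma tsallis_term_strong_concavity (R : realType) (alpha a b : R) :
  1 <= alpha <= 2 -> 0 <= a <= 1 -> 0 <= b <= 1 ->
  2^-1 * (tsallis_term alpha a + tsallis_term alpha b) + 8^-1 * (a - b) ^+ 2 <=
  tsallis_term alpha (2^-1 * (a + b)).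
Proof.
move=> a12; have /andP[a1 _] := a12.
apply: (@midpoint_strong_concavity _ _ (tsallis_term_deriv alpha)).
- exact: tsallis_term_continuous.
- by move=> x /andP[x0 _]; exact: tsallis_term_is_derive.
- by move=> x y; exact: tsallis_term_deriv_decr.
Qed.

(** * The simplex and existence of the maximizer *)

Lemma simplex_itv (R : realType) M (p : 'cV[R]_M) i :
  simplex R M p -> 0 <= p i 0 <= 1.
Proof.
move=> [p0 p1]; rewrite p0/= -p1 (bigD1 i)//= lerDl.
by apply: sumr_ge0 => j _; exact: p0.
Qed.

Lemma simplex_midpoint (R : realType) M (p q : 'cV[R]_M) :
  simplex R M p -> simplex R M q -> simplex R M (2^-1 *: (p + q)).
Proof.
move=> [p0 p1] [q0 q1]; split=> [i|].
  by rewrite !mxE mulr_ge0 ?invr_ge0 ?addr_ge0.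
under eq_bigr do rewrite !mxE.
by rewrite -mulr_sumr big_split/= p1 q1; lra.
Qed.

Lemma sum_continuous (R : realType) (T : topologicalType) n
    (f : 'I_n -> T -> R) :
  (forall i, continuous (f i)) -> continuous (fun x => \sum_(i < n) f i x).
Proof.
by move=> fc x; apply: cvg_big => [|i _]; [exact: add_continuous|exact: fc].
Qed.

(** The simplex is a closed subset of the cube [0, 1]^M. It is transposed to row vectors to match
    [rV_compact] and [EVT_max_rV]. *)
Lemma simplex_compact (R : realType) M :
  compact [set v : 'rV[R]_M | simplex R M v^T].
Proof.
have sumc : continuous (fun v : 'rV[R]_M => \sum_(i < M) v 0 i).
  by apply: sum_continuous => i; exact: coord_continuous.
have := compact_closedI
  (@rV_compact R M (fun=> `[0, 1]%classic) (fun=> @segment_compact R 0 1))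
  (@preimage_closed _ _ _ _ (in1W sumc) (@closed_eq R 1)).
congr compact; apply/seteqP; split => v /=.
  move=> [v01 v1]; split=> [i|]; last by under eq_bigr do rewrite mxE.
  by have := v01 i; rewrite in_itv/= mxE => /andP[].
move=> vS; split=> [i|].
  by have := simplex_itv i vS; rewrite in_itv/= mxE.
by case: vS => _ <-; apply: eq_bigr => i _; rewrite mxE.
Qed.

Definition is_entmax (R : realType) M (alpha : R) (z p : 'cV[R]_M) : Prop :=
  simplex R M p /\ forall q, simplex R M q ->
    dotp q z + tsallis alpha q <= dotp p z + tsallis alpha p.

(** A continuous objective attains its maximum on the nonempty compact simplex, so [get] returns a
    true maximizer and not its default value. *)
Lemma entmaxP (R : realType) M (alpha : R) (z : 'cV[R]_M) :
  (0 < M)%N -> 1 <= alpha -> is_entmax alpha z (entmax alpha z).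
Proof.
move=> M0 a1; apply: getPex.
pose A := [set v : 'rV[R]_M | simplex R M v^T].
pose f (v : 'rV[R]_M) :=
  \sum_(i < M) (v 0 i * z i 0 + tsallis_term alpha (v 0 i)).
have fE p : simplex R M p -> dotp p z + tsallis alpha p = f p^T.
  move=> pS; rewrite tsallis_sum// -big_split/=.
  by apply: eq_bigr => i _; rewrite mxE.
have A0 : A !=set0.
  exists (\row_(i < M) (M%:R^-1)); split=> [i|].
    by rewrite !mxE invr_ge0.
  under eq_bigr do rewrite !mxE.
  rewrite sumr_const card_ord -[LHS]mulr_natl divff// pnatr_eq0.
  by rewrite -lt0n.
have fc : continuous f.
  apply: sum_continuous => i v.
  have vi : (fun u : 'rV[R]_M => u 0 i) @ v --> v 0 i.
    exact: coord_continuous.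
  have tc : {for v 0 i, continuous (tsallis_term alpha)}.
    exact: tsallis_term_continuous.
  exact: cvgD (cvgM vi (cvg_cst _)) (continuous_cvg _ tc vi).
have [v vA vmax] := EVT_max_rV A0 (@simplex_compact R M)
  (continuous_subspaceT fc).
exists v^T; split; first by rewrite inE in vA.
move=> q qS; rewrite !fE ?trmxK//; last by rewrite inE in vA.
by apply: vmax; rewrite inE /A/= trmxK.
Qed.

(** * Stability of the maximizer and differentiability of the conjugate *)

Lemma tsallis_strong_concavity (R : realType) M (alpha : R) (p q : 'cV[R]_M) :
  1 <= alpha <= 2 -> simplex R M p -> simplex R M q ->
  2^-1 * (tsallis alpha p + tsallis alpha q) + 8^-1 * sqnorm (p - q) <=
  tsallis alpha (2^-1 *: (p + q)).
Proof.
move=> a12 pS qS; rewrite !tsallis_sum//; last exact: simplex_midpoint.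
rewrite -big_split/= mulr_sumr /sqnorm /dotp mulr_sumr -big_split/=.
apply: ler_sum => i _; rewrite !mxE -expr2.
by apply: tsallis_term_strong_concavity => //; exact: simplex_itv.
Qed.

(** The maximizer p is compared with the midpoint of p and q, where strong concavity gains |p -
    q|^2/8; clearing the factor 1/2 doubles this to 1/4. Uniqueness of the maximizer is contained in
    it. *)
Lemma entmax_gap (R : realType) M (alpha : R) (z p q : 'cV[R]_M) :
  1 <= alpha <= 2 -> is_entmax alpha z p -> simplex R M q ->
  dotp q z + tsallis alpha q + 4^-1 * sqnorm (p - q) <=
  dotp p z + tsallis alpha p.
Proof.
move=> a12 [pS pmax] qS.
have := pmax _ (simplex_midpoint pS qS); rewrite dotpZl dotpDl.
have := tsallis_strong_concavity a12 pS qS; lra.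
Qed.

(** Testing each maximizer against the other and adding the two gaps gives |q - p|^2/2 <= <q - p, z'
    - z>; Young's inequality then absorbs half of the left side. *)
Lemma entmax_lipschitz (R : realType) M (alpha : R) (z z' : 'cV[R]_M) :
  (0 < M)%N -> 1 <= alpha <= 2 ->
  sqnorm (entmax alpha z' - entmax alpha z) <= 4 * sqnorm (z' - z).
Proof.
move=> M0 a12; have /andP[a1 _] := a12.
move: (entmaxP z M0 a1) (entmaxP z' M0 a1).
move: (entmax alpha z) (entmax alpha z') => p q pP qP.
have := entmax_gap a12 pP qP.1; have := entmax_gap a12 qP pP.1.
have := dotp_le_sqnorm (q - p) (z' - z).
have -> : sqnorm (p - q) = sqnorm (q - p).
  by rewrite -opprB -scaleN1r sqnormZ sqrrN expr1n mul1r.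
rewrite dotpBl !dotpBr.
move: (dotp p z) (dotp p z') (dotp q z) (dotp q z') => pz pz' qz qz'.
move: (tsallis alpha p) (tsallis alpha q) (sqnorm (q - p)) => *; lra.
Qed.

(* The convex conjugate of the negative entropy. *)
Definition entmax_value (R : realType) M (alpha : R) (z : 'cV[R]_M) : R :=
  dotp (entmax alpha z) z + tsallis alpha (entmax alpha z).

(** The maximizer for z is a competitor in the problem for z', and its objective is affine in the
    second argument. *)
Lemma entmax_value_subgradient (R : realType) M (alpha : R) (z z' : 'cV[R]_M) :
  (0 < M)%N -> 1 <= alpha ->
  entmax_value alpha z + dotp (entmax alpha z) (z' - z) <=
  entmax_value alpha z'.
Proof.
move=> M0 a1; have [_ zmax] := entmaxP z' M0 a1.
have := zmax _ (entmaxP z M0 a1).1; rewrite /entmax_value dotpBr.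
by rewrite (addrC (_ + _)) addrA subrK.
Qed.

Lemma scaled_entmax_value_gradient (R : realType) M (alpha beta : R)
    (z : 'cV[R]_M) :
  (0 < M)%N -> 1 <= alpha <= 2 -> 0 < beta ->
  has_gradient (fun u => beta^-1 * entmax_value alpha (beta *: u)) z
    (Sep alpha beta z).
Proof.
move=> M0 a12 b0; have /andP[a1 _] := a12.
(* With k = beta h, the subgradients at both ends place the remainder of the conjugate between 0 and
   <p' - p, k>. Young and the Lipschitz bound give at most |k|^2 + |k|^2, and division by beta
   leaves 2 beta |h|^2. *)
apply: (@has_gradient_quadratic _ _ _ _ _ (2 * beta)) => h.
rewrite /Sep scalerDr; set w := beta *: z; set k := beta *: h.
have hE : dotp (entmax alpha w) h = beta^-1 * dotp (entmax alpha w) k.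
  by rewrite /k dotpZr mulKf ?gt_eqF.
have kE : beta * sqnorm h = beta^-1 * sqnorm k.
  by rewrite /k sqnormZ; field; rewrite gt_eqF.
rewrite hE -mulrA kE -!mulrBr mulrCA normrM gtr0_norm ?invr_gt0//.
rewrite ler_wpM2l ?invr_ge0 ?(ltW b0)//.
have wk : w + k - w = k by rewrite addrAC subrr add0r.
have kw : w - (w + k) = - k by rewrite opprD addrA subrr sub0r.
have := entmax_value_subgradient w (w + k) M0 a1.
have := entmax_value_subgradient (w + k) w M0 a1.
have := entmax_lipschitz w (w + k) M0 a12.
have := dotp_le_sqnorm (entmax alpha (w + k) - entmax alpha w) k.
rewrite dotpBl wk kw -(scaleN1r k) (dotpZr (-1)).
set p := dotp (entmax alpha (w + k)) k; set q := dotp (entmax alpha w) k.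
move: p q (sqnorm k) (sqnorm (_ - _)) => p q K D.
move: (entmax_value alpha (w + k)) (entmax_value alpha w) => V' V *.
by rewrite ger0_norm; lra.
Qed.

(** * The closed formulas for alpha = 1 and alpha = 2 *)

Lemma mul_ln_sub_le (R : realType) (p s : R) :
  0 <= p -> 0 < s -> p * (ln s - ln p) <= s - p.
Proof.
rewrite le_eqVlt => /predU1P[<- s0|p0 s0].
  by rewrite mul0r subr0 ltW.
have sp0 : 0 < s / p by rewrite divr_gt0.
have : ln (s / p) <= s / p - 1.
  by have := @le_ln1Dx _ (s / p - 1); rewrite addrCA subrr addr0; apply; lra.
rewrite ln_div// => /(ler_wpM2l (ltW p0)) /le_trans; apply.
by rewrite mulrBr mulr1 mulrCA divff ?gt_eqF// mulr1.
Qed.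

(* Gibbs' variational principle: the maximum is attained at the softmax. *)
Lemma entmax_value1 (R : realType) M (z : 'cV[R]_M) :
  (0 < M)%N -> entmax_value 1 z = ln (\sum_(mu < M) expR (z mu 0)).
Proof.
move=> M0; set Z := \sum_(mu < M) _.
have Z0 : 0 < Z.
  rewrite /Z (bigD1 (Ordinal M0))//= ltr_pwDl ?expR_gt0//.
  by apply: sumr_ge0 => i _; exact: expR_ge0.
pose s : 'cV[R]_M := \col_mu (expR (z mu 0) / Z).
have s0 i : 0 < s i 0 by rewrite mxE divr_gt0 ?expR_gt0.
have sS : simplex R M s.
  split=> [i|]; first exact: ltW.
  by under eq_bigr do rewrite mxE; rewrite -mulr_suml divff ?gt_eqF.
have ln_s i : ln (s i 0) = z i 0 - ln Z.
  by rewrite mxE ln_div ?posrE ?expR_gt0// expRK.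
have valE p : dotp p z + tsallis 1 p =
    \sum_(i < M) p i 0 * (z i 0 - ln (p i 0)).
  rewrite /tsallis eqxx -sumrN -big_split/=.
  by apply: eq_bigr => i _; rewrite mulrBr.
have [pS pmax] := entmaxP z M0 (lexx 1).
apply/eqP; rewrite eq_le; apply/andP; split.
  (* Upper bound: z_i - ln Z = ln s_i, so the excess over ln Z is the sum of p_i (ln s_i - ln p_i),
     at most the sum of s_i - p_i, which is 0. *)
  rewrite /entmax_value valE -subr_le0; set p := entmax _ _ in pS *.
  have -> : ln Z = \sum_(i < M) p i 0 * ln Z.
    by rewrite -mulr_suml pS.2 mul1r.
  rewrite -sumrB (@le_trans _ _ (\sum_(i < M) (s i 0 - p i 0)))//.
    apply: ler_sum => i _; apply: le_trans (mul_ln_sub_le (pS.1 i) (s0 i)).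
    by rewrite ln_s -mulrBr addrAC.
  by rewrite sumrB pS.2 sS.2 subrr.
(* Lower bound: at the softmax every z_i - ln s_i equals ln Z. *)
apply: le_trans (pmax _ sS); rewrite valE.
under eq_bigr do rewrite ln_s subKr.
by rewrite -mulr_suml sS.2 mul1r.
Qed.

Lemma tsallis2 (R : realType) M (p : 'cV[R]_M) :
  simplex R M p -> tsallis 2 p = 2^-1 * (1 - sqnorm p).
Proof.
move=> [p0 p1]; rewrite /tsallis ifF; last by apply/eqP; lra.
rewrite (_ : (2 * (2 - 1))^-1 = 2^-1 :> R); last by congr _^-1; lra.
congr (_ * _); rewrite sumrB p1; congr (_ - _).
by apply: eq_bigr => i _; rewrite -expr2 (powR_mulrn 2)// p0.
Qed.

(** On the simplex the objective for alpha = 2 is (1 + |z|^2 - |p - z|^2)/2, so both problems have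
    the same set of solutions and [get] selects the same point. *)
Lemma sparsemaxE (R : realType) M (z : 'cV[R]_M) : sparsemax z = entmax 2 z.
Proof.
congr get; apply/funext => p; apply/propext.
suff pq q : simplex R M p -> simplex R M q ->
    (sqnorm (p - z) <= sqnorm (q - z)) =
    (dotp q z + tsallis 2 q <= dotp p z + tsallis 2 p).
  by split=> -[pS pmax]; split=> // q qS; have := pmax q qS; rewrite pq.
move=> pS qS; rewrite !tsallis2// !sqnormB.
move: (sqnorm p) (sqnorm q) (sqnorm z) (dotp p z) (dotp q z) => *.
by apply/idP/idP; lra.
Qed.

Lemma entmax_value2 (R : realType) M (z : 'cV[R]_M) : (0 < M)%N ->
  entmax_value 2 z =
  2^-1 * sqnorm z - 2^-1 * sqnorm (sparsemax z - z) + 2^-1.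
Proof.
move=> M0; have a1 : 1 <= 2 :> R by lra.
have [pS _] := entmaxP z M0 a1.
rewrite sparsemaxE sqnormB /entmax_value tsallis2//.
move: (sqnorm z) (sqnorm (entmax 2 z)) (dotp _ _) => *; lra.
Qed.

(** Both closed formulas are the conjugate scaled by 1/beta; in the remaining case the gradient is
    given by definition. *)
Lemma Psi_star_gradient (R : realType) M (alpha beta : R) (F : 'cV[R]_M -> R)
    (z : 'cV[R]_M) :
  (0 < M)%N -> 0 < beta -> 1 <= alpha <= 2 -> is_Psi_star alpha beta F ->
  has_gradient F z (Sep alpha beta z).
Proof.
move=> M0 b0 a12 [[a1 FE]|[a2 FE]|]; last exact.
- have -> : F = fun u => beta^-1 * entmax_value alpha (beta *: u).
    apply/funext => u; rewrite FE a1 entmax_value1//.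
    by congr (_ * ln _); apply: eq_bigr => i _; rewrite mxE.
  exact: scaled_entmax_value_gradient.
- have -> : F = fun u => beta^-1 * entmax_value alpha (beta *: u).
    by apply/funext => u; rewrite FE a2 entmax_value2.
  exact: scaled_entmax_value_gradient.
Qed.

(** * Continuity, energy gradient and descent for the retrieval map *)

Lemma Sep_continuous (R : realType) M (alpha beta : R) :
  (0 < M)%N -> 1 <= alpha <= 2 -> continuous (@Sep R M alpha beta).
Proof.
move=> M0 a12 z; apply/(@cvgrPdist_le _ _ _ (nbhs z)) => e e0.
(* C - 1 bounds the squared Lipschitz constant for the sup norm; the added 1 gives C >= 1, hence C -
   1 <= C^2, and C can serve as the constant itself. *)
pose C := 4 * (beta ^+ 2 * M%:R) + 1.
have C0 : 0 < C by rewrite ltr_wpDl// mulr_ge0// mulr_ge0// sqr_ge0.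
have Ce0 : 0 < C^-1 * e by rewrite mulr_gt0 ?invr_gt0.
have zC : \forall u \near z, `|z - u| <= C^-1 * e.
  exact: (@cvgr_dist_le R _ _ (nbhs z) _ id z (@cvg_id _ (nbhs z)) _ Ce0).
near=> u; have zu : `|z - u| <= C^-1 * e by near: u.
have zuC : C * `|z - u| <= e by rewrite -ler_pdivlMl.
apply: le_trans zuC; apply: norm_le_coord => [|i].
  by rewrite mulr_ge0 ?(ltW C0).
rewrite -(@ler_pXn2r _ 2)// ?nnegrE ?mulr_ge0 ?(ltW C0)//.
rewrite real_normK ?num_real// (le_trans (sqr_coord_le_sqnorm _ _))//.
rewrite (le_trans (entmax_lipschitz _ _ M0 a12))// -scalerBr sqnormZ.
apply: (@le_trans _ _ (C * `|z - u| ^+ 2)).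
  apply: (@le_trans _ _ (4 * (beta ^+ 2 * (M%:R * `|z - u| ^+ 2)))).
    by rewrite ler_wpM2l// ler_wpM2l ?sqr_ge0// sqnorm_le_norm.
  rewrite [leLHS](_ : _ = (C - 1) * `|z - u| ^+ 2); last by rewrite /C; ring.
  by rewrite ler_wpM2r ?sqr_ge0// gerBl.
rewrite exprMn ler_wpM2r ?sqr_ge0// expr2 ler_peMl ?(ltW C0)//.
by rewrite /C lerDr mulr_ge0// mulr_ge0// sqr_ge0.
Unshelve. all: by end_near. Qed.

Lemma kernelXiE (R : realType) d D M (W : 'M[R]_(D, d)) (Xi : 'M[R]_(d, M)) x :
  kernelXi W Xi x = (W *m Xi)^T *m W *m x.
Proof.
apply/colP => mu; rewrite mxE /kernelK /Phi dotpE -mulmxA.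
rewrite [LHS]mxE [RHS]mxE; apply: eq_bigr => i _; congr (_ * _).
by rewrite !mxE; apply: eq_bigr => j _; rewrite !mxE.
Qed.

(** Chain rule: the transpose of the matrix of [kernelXi] is W^T W Xi, so both terms of the energy
    share the factor W^T W. *)
Lemma energy_gradient (R : realType) d D M (W : 'M[R]_(D, d))
    (Xi : 'M[R]_(d, M)) (Psi : 'cV[R]_M -> R) (x : 'cV[R]_d) g :
  has_gradient Psi (kernelXi W Xi x) g ->
  has_gradient (energy W Xi Psi) x (W^T *m (W *m (x - Xi *m g))).
Proof.
rewrite kernelXiE => Psig.
have -> : energy W Xi Psi = fun u =>
    2^-1 * sqnorm (W *m u) - Psi ((W *m Xi)^T *m W *m u).
  by apply/funext => u; rewrite /energy kernelXiE.
have -> : W^T *m (W *m (x - Xi *m g)) =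
    W^T *m (W *m x) - ((W *m Xi)^T *m W)^T *m g.
  by rewrite trmx_mul trmxK !mulmxBr !mulmxA.
apply: has_gradientB; last exact: has_gradient_mulmx.
exact: (has_gradient_mulmx (half_sqnorm_gradient (W *m x))).
Qed.

Lemma retrieval_continuous (R : realType) d D M (W : 'M[R]_(D, d))
    (Xi : 'M[R]_(d, M)) (alpha beta : R) :
  (0 < M)%N -> 1 <= alpha <= 2 -> continuous (retrieval W Xi alpha beta).
Proof.
move=> M0 a12.
have Kc : continuous (kernelXi W Xi).
  have -> : kernelXi W Xi = mulmx ((W *m Xi)^T *m W).
    by apply/funext => u; rewrite kernelXiE.
  exact: linear_cV_continuous.
have -> : retrieval W Xi alpha beta =
    mulmx Xi \o (Sep alpha beta \o kernelXi W Xi) by [].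
move=> x; apply: continuous_comp; last exact: linear_cV_continuous.
by apply: continuous_comp; [exact: Kc|exact: Sep_continuous].
Qed.

Lemma retrieval_descent (R : realType) d D M (W : 'M[R]_(D, d))
    (Xi : 'M[R]_(d, M)) (alpha beta : R) (x : 'cV[R]_d)
    (E := energy W Xi (fun z => beta^-1 * entmax_value alpha (beta *: z)))
    (x' := retrieval W Xi alpha beta x) :
  (0 < M)%N -> 1 <= alpha -> 0 < beta ->
  2^-1 * sqnorm (W *m (x - x')) <= E x - E x'.
Proof.
move=> M0 a1 b0; pose A := (W *m Xi)^T *m W.
have x'E : x' = Xi *m entmax alpha (beta *: (A *m x)).
  by rewrite /x' /retrieval /Sep kernelXiE.
rewrite /E /energy !kernelXiE -/A; clearbody x'.
have divide_beta (V V' c : R) :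
    V + beta * c <= V' -> c <= beta^-1 * V' - beta^-1 * V.
  by move=> VV'; rewrite -mulrBr ler_pdivlMl//; lra.
have := entmax_value_subgradient (beta *: (A *m x)) (beta *: (A *m x')) M0 a1.
rewrite -scalerBr -mulmxBr dotpZr => /divide_beta.
move: (entmax alpha _) x'E => s x'E.
(* As x' = Xi s, the subgradient term is <W x', W x' - W x>; together with (|W x|^2 - |W x'|^2)/2 it
   completes the square |W x - W x'|^2/2. *)
have -> : dotp s (A *m (x' - x)) = dotp (W *m x') (W *m (x' - x)).
  by rewrite x'E /A -[in LHS]mulmxA dotp_mulmxr trmxK -mulmxA.
rewrite /kernelK /Phi !mulmxBr sqnormB dotpBr (dotpC (W *m x)) /sqnorm.
move: (entmax_value alpha (beta *: (A *m x))) => V.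
move: (entmax_value alpha (beta *: (A *m x'))) => V'.
move: (dotp (W *m x) (W *m x)) (dotp (W *m x') (W *m x')) (dotp _ _) => *.
lra.
Qed.

Theorem lemma2p1 (R : realType) (d DPhi M : nat)
  (hd : (1 <= d)%N) (hDPhi : (1 <= DPhi)%N) (hM : (1 <= M)%N)
  (hdDPhi : (d <= DPhi)%N)
  (beta alpha : R) (hbeta : 0 < beta) (halpha : 1 <= alpha <= 2)
  (Xi : 'M[R]_(d, M)) (W : 'M[R]_(DPhi, d))
  (Psi_star : 'cV[R]_M -> R) (hPsi : is_Psi_star alpha beta Psi_star)
  (x : nat -> 'cV[R]_d)
  (hx : forall t, x t.+1 = retrieval W Xi alpha beta (x t)) :
  forall y : 'cV[R]_d, subseq_limit_point x y ->
    stationary_point (energy W Xi Psi_star) y.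
Proof.
move=> y [f f_incr xfy]; have /andP[a1 _] := halpha.
have := energy_gradient
  (Psi_star_gradient (kernelXi W Xi y) hM hbeta halpha hPsi).
rewrite -[Xi *m _]/(retrieval W Xi alpha beta y).
suff -> : W *m (y - retrieval W Xi alpha beta y) = 0 by rewrite mulmx0.
(* The descent is run on the conjugate-based energy; it has the same gradient as the energy built
   from the given [Psi_star]. *)
pose E := energy W Xi (fun z => beta^-1 * entmax_value alpha (beta *: z)).
pose g u := 2^-1 * sqnorm (W *m (u - retrieval W Xi alpha beta u)).
have Ec : {for y, continuous E}.
  apply: has_gradient_continuous; apply: energy_gradient.
  exact: scaled_entmax_value_gradient.
have gc : {for y, continuous g}.
  pose r u := u - retrieval W Xi alpha beta u.
  have rc : {for y, continuous r}.
    have Tc := @retrieval_continuous _ _ _ _ W Xi _ beta hM halpha.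
    exact: cvgB (@cvg_id _ (nbhs y)) (Tc y).
  have Wc : {for r y, continuous (mulmx W : 'cV[R]_d -> 'cV[R]_DPhi)}.
    exact: linear_cV_continuous.
  have qc := has_gradient_continuous (half_sqnorm_gradient (W *m r y)).
  exact: (continuous_comp (continuous_comp rc Wc) qc).
have descent t : g (x t) <= E (x t) - E (x t.+1).
  by rewrite hx; exact: retrieval_descent.
have E_decr : {homo E \o x : m n / (m <= n)%N >-> n <= m}.
  apply: homo_leq => [||t]; [by []|by move=> ? ? ? /[swap]; exact: le_trans|].
  rewrite -subr_ge0; apply: le_trans (descent t).
  by rewrite mulr_ge0 ?invr_ge0// sqnorm_ge0.
clearbody E.
have Exf : (fun k => E (x (f k))) @ \oo --> E y.
  exact: continuous_cvg _ Ec xfy.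
have Exf' : (fun k => E (x (f k.+1))) @ \oo --> E y.
  by rewrite -(cvg_shiftS (fun k => E (x (f k)))) in Exf.
have gxf : (fun k => g (x (f k))) @ \oo --> g y.
  exact: continuous_cvg _ gc xfy.
have : g y <= E y - E y.
  (* Since f k + 1 <= f (k + 1), monotonicity bounds the drop of one step by the drop between
     consecutive terms of the subsequence, and both of these converge to [E y]. *)
  have gE k : g (x (f k)) <= E (x (f k)) - E (x (f k.+1)).
    apply: le_trans (descent _) _; rewrite lerD2l lerN2.
    by apply: E_decr; exact: f_incr.
  have := ler_cvg_to gxf (cvgB Exf Exf').
  by apply; apply: nearW => k; exact: gE.
rewrite subrr /g => gy0; apply: sqnorm_eq0; by move: (sqnorm _) gy0 => *; lra.
Qed.
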